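(* Let $T\colon[0,1]\to[0,1]$ be a Borel measurable map, let $\eta$ be a $T$-invariant ergodic Borel probability measure on $[0,1]$, and let $f\in L^1([0,1],\eta)$ be real-valued, non-negative and bounded. For $y\in[0,1]$ let $\mu_y$ be the $f$-weighted return time measure with respect to $T$ and with reference point $y$. Then for $\eta$-almost every $y\in[0,1]$ the autocorrelation $\gamma_{\mu_y}$ exists and $$\gamma_{\mu_y}=\sum_{z\in\mathbb{Z}}\Xi(T,\eta)(z)\,\delta_z .$$
   Context: $T$ is called invertible if it is a bijection with Borel measurable inverse; then $T^z$ is defined for all $z\in\mathbb{Z}$. For $z\in\mathbb{Z}$, $\delta_z$ denotes the Dirac point mass at $z$. The $f$-weighted return time measure with respect to $T$ and with reference point $y$ is the measure on $\mathbb{Z}$ $$\mu_y=\sum_{n\in\mathbb{N}_0} f(T^n(y))\,\delta_n \ \text{ if $T$ is non-invertible},\qquad \mu_y=\sum_{z\in\mathbb{Z}} f(T^z(y))\,\delta_z\ \text{ if $T$ is invertible}.$$ For a measure $\mu$ on $\mathbb{Z}$, $\widetilde{\mu}$ is the measure with $\widetilde{\mu}(A)=\overline{\mu(-A)}$, $\mu|_n$ is the restriction of $\mu$ to $B_n=\{x\in\mathbb{Z}:|x|\le n\}$, and $*$ is convolution of measures, $(\mu*\nu)(A)=\iint \mathbf{1}_A(x+y)\,d\mu(x)\,d\nu(y)$. The autocorrelation $\gamma_\mu$ of $\mu$ is, if it exists, the vague limit (i.e. limit against every finitely supported function on $\mathbb{Z}$, equivalently pointwise convergence of the masses at each $z\in\mathbb{Z}$)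 of the sequence $\frac{1}{2n+1}\,\mu|_n*\widetilde{\mu|_n}$ as $n\to\infty$. For $z\in\mathbb{Z}$, $$\Xi(T,\eta)(z)=\frac12\int f\circ T^{|z|}\cdot f\,d\eta\ \text{ if $T$ is non-invertible},\qquad \Xi(T,\eta)(z)=\int f\circ T^{-z}\cdot f\,d\eta\ \text{ if $T$ is invertible}.$$ *)

(* Defs.v *)
From HB Require Import structures.
From mathcomp Require Import all_boot all_order all_algebra.
From mathcomp Require Import all_classical all_reals all_analysis.
Set Implicit Arguments. Unset Strict Implicit. Unset Printing Implicit Defensive.
Import Order.TTheory GRing.Theory Num.Theory.
Import numFieldNormedType.Exports.
Local Open Scope classical_set_scope.
Local Open Scope ring_scope.

Section Defs.
Variable R : realType.

Definition I01 : set R := `[0%R, 1%R].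

Definition invertible (T : R -> R) : Prop :=
  exists g : R -> R,
    [/\ (forall x, I01 x -> I01 (g x)),
        (forall x, I01 x -> g (T x) = x),
        (forall x, I01 x -> T (g x) = x) &
        measurable_fun I01 g].

(* a chosen inverse (any two agree on [0,1]) *)
Definition Tinv (T : R -> R) : R -> R :=
  match pselect (invertible T) with
  | left H => projT1 (cid H)
  | right _ => id
  end.

Definition Tpow (T : R -> R) (z : int) : R -> R :=
  match z with
  | Posz n => iter n T
  | Negz n => iter n.+1 (Tinv T)
  end.

(* masses of the f-weighted return time measure mu_y on Z:
   mu_y = sum_z mu_y(z) delta_z *)
Definition return_measure (T : R -> R) (f : R -> R) (y : R) (z : int) : R :=
  if `[< invertible T >] then f (Tpow T z y)
  else if (0 <= z) then f (Tpow T z y) else 0.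

Definition restr (m : int -> R) (n : nat) (z : int) : R :=
  if (`|z| <= n%:Z) then m z else 0.

(* mu~(A) = conj(mu(-A)); masses are real here, so conj is the identity *)
Definition tilde (m : int -> R) (z : int) : R := m (- z).

(* convolution of two measures supported in B_n, mass at z:
   (a * b)({z}) = sum_{x in B_n} a(x) b(z - x) *)
Definition conv_n (n : nat) (a b : int -> R) (z : int) : R :=
  \sum_(0 <= i < (2 * n).+1) a (i%:Z - n%:Z) * b (z - (i%:Z - n%:Z)).

Definition autocorr_seq (m : int -> R) (n : nat) (z : int) : R :=
  ((2 * n).+1%:R)^-1 * conv_n n (restr m n) (tilde (restr m n)) z.

Definition Xi (T : R -> R) (eta : probability R R) (f : R -> R) (z : int) : R :=
  if `[< invertible T >] then
    Rintegral eta I01 (fun x => f (Tpow T (- z) x) * f x)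
  else
    2^-1 * Rintegral eta I01 (fun x => f (Tpow T `|z|%:Z x) * f x).

End Defs.
Arguments I01 {R}.

(* Main.v *)
Require Import Defs.
From HB Require Import structures.
From mathcomp Require Import all_boot all_order all_algebra.
From mathcomp Require Import all_classical all_reals all_analysis.
From mathcomp Require Import measurable_realfun ring lra zify.
Import Order.TTheory GRing.Theory Num.Theory.
Import numFieldNormedType.Exports.
Local Open Scope classical_set_scope.
Local Open Scope ring_scope.
Set Implicit Arguments. Unset Strict Implicit. Unset Printing Implicit Defensive.

(** Up to a number of boundary terms bounded by [2 * |z|], the autocorrelation
    at [z] is the average of [mu_y(x) mu_y(x - z)] over [|x| <= n].  Its halves
    [x >= 0] and [x < 0] are Birkhoff averages, along [T] and along the inverse
    of [T], of a single bounded function whose integral is [Xi z] (invertible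
    case), resp. [2 * Xi z] with a vanishing second half (non-invertible case).

    The ergodic theorem for a bounded [g] follows from the fact that
    [\int g < 0] forces the Birkhoff sums of [g] to be bounded above almost
    everywhere, applied to [g - \int g - e] and [\int g - g - e]. *)

(** * Pointwise ergodic theorem for bounded observables *)

Section Birkhoff.
Context {d : measure_display} {X : measurableType d} {R : realType}.
Variables (P : probability X R) (T : X -> X).
Hypothesis mT : measurable_fun [set: X] T.
Hypothesis invT : forall A, measurable A -> P (T @^-1` A) = P A.
Hypothesis ergT :
  forall A, measurable A -> T @^-1` A = A -> P A = 0%E \/ P A = 1%E.

Lemma bounded_integrable (g : X -> R) (C : R) :
  measurable_fun [set: X] g -> (forall x, `|g x| <= C) ->
  P.-integrable [set: X] (EFin \o g).
Proof.
move=> mg gC; apply: measurable_bounded_integrable => //.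
  by rewrite -ge0_fin_numE ?fin_num_measure.
by exists C; split; [exact: num_real|move=> y Cy x _; exact: le_trans (gC x) (ltW Cy)].
Qed.

(** Change of variables: by [invT], the pushforward of [P] along [T] agrees with [P] on measurable
    sets. *)
Lemma Rintegral_invariant (h : X -> R) :
  measurable_fun [set: X] h -> (forall x, 0 <= h x) ->
  \int[P]_x h (T x) = \int[P]_x h x.
Proof.
move=> mh h0; rewrite /Rintegral; congr fine.
have mEh : measurable_fun [set: X] (EFin \o h) by exact: measurableT_comp.
have h0' : {in [set: X], forall y, (0 <= (EFin \o h) y)%E}.
  by move=> y _; rewrite lee_fin.
have := ge0_integral_pushforward mT P measurableT mEh h0'.
rewrite preimage_setT => <-.
apply: eq_measure_integral => A mA _; exact: invT.
Qed.

Section maximal_sums.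
Variables (g : X -> R) (C : R).
Hypotheses (mg : measurable_fun [set: X] g) (gC : forall x, `|g x| <= C).

(** This is the maximum of the Birkhoff sums of [g] of lengths 0 to [n]. Peeling off the first term
    gives a recursion that relates [x] to [T x] directly. *)
Fixpoint maxsum n (x : X) : R :=
  if n is n'.+1 then Num.max 0 (g x + maxsum n' (T x)) else 0.

Lemma maxsum_ge0 n x : 0 <= maxsum n x.
Proof. by case: n => //= n; rewrite le_max lexx. Qed.

Lemma maxsum_le n x : maxsum n x <= n%:R * C.
Proof.
have C0 : 0 <= C by exact: le_trans (gC point).
elim: n x => [x|n IH x] /=; first by rewrite mul0r.
rewrite ge_max mulr_ge0 //= -natr1 mulrDl mul1r addrC lerD //.
exact: le_trans (ler_norm _) (gC _).
Qed.

Lemma maxsum_leS n x : maxsum n x <= maxsum n.+1 x.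
Proof.
elim: n x => [x|n IH x]; first exact: maxsum_ge0.
rewrite [leRHS]/= [leLHS]/= ge_max !le_max lexx /= lerD2l.
by rewrite [X in _ || X](IH (T x)) orbT.
Qed.

Lemma maxsum_homo x : {homo maxsum^~ x : m n / (m <= n)%N >-> m <= n}.
Proof. by apply: homo_leq => [//|y u v|n]; [exact: le_trans|exact: maxsum_leS]. Qed.

Lemma sum_le_maxsum n x : \sum_(k < n) g (iter k T x) <= maxsum n x.
Proof.
elim: n x => [x|n IH x]; first by rewrite big_ord0.
rewrite big_ord_recl /= le_max; apply/orP; right; rewrite lerD2l.
by under eq_bigr do rewrite -iterS iterSr; exact: IH.
Qed.

Lemma measurable_maxsum n : measurable_fun [set: X] (maxsum n).
Proof.
elim: n => [|n IH] /=; first exact: measurable_cst.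
apply: measurable_maxr; first exact: measurable_cst.
by apply: measurable_funD => //; exact: measurableT_comp.
Qed.

Definition maxsum_unbounded : set X :=
  \bigcap_(K : nat) \bigcup_n [set x | K%:R < maxsum n x].

Lemma measurable_maxsum_unbounded : measurable maxsum_unbounded.
Proof.
apply: bigcapT_measurable => K; apply: bigcupT_measurable => n.
rewrite -[X in measurable X]setTI.
have := @measurable_fun_ltr _ X R setT (cst K%:R) (maxsum n)
  (measurable_cst _) (measurable_maxsum n).
by move=> /(_ measurableT [set true] I).
Qed.

(** One step of the recursion changes a positive maximum by a single value of [g], hence by at most
    [C]. A threshold above [K + C] at one of [x], [T x] therefore yields the threshold [K] at the
    other. *)
Lemma maxsum_unbounded_invariant : T @^-1` maxsum_unbounded = maxsum_unbounded.
Proof.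
apply/seteqP; split => x /= Ax K _.
- have [n _ /= Kn] := Ax (Num.truncn (K%:R + C)).+1 I.
  exists n.+1 => //=; rewrite lt_max; apply/orP; right.
  have := gC x; rewrite ler_norml => /andP[gC1 _].
  have := truncnS_gt (K%:R + C); lra.
- have [n _ /=] := Ax (Num.truncn (K%:R + C)).+1 I.
  have := truncnS_gt (K%:R + C).
  have C0 : 0 <= C by exact: le_trans (gC point).
  have K0 : 0 <= K%:R :> R by [].
  case: n => [/=|n /= Kt]; first by lra.
  rewrite lt_max => /orP[|Kn]; first by lra.
  exists n => //=.
  have := gC x; rewrite ler_norml => /andP[_ gC2]; lra.
Qed.

(* If the running maxima [M_n] were unbounded almost everywhere, the
   differences [M_(n+1) - M_n \o T = max(g, - M_n \o T)], whose integrals are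
   nonnegative by invariance, would decrease to [g]. *)
Lemma ae_sum_bounded_above : \int[P]_x g x < 0 ->
  {ae P, forall x, exists K : R,
    forall n, \sum_(k < n) g (iter k T x) <= K}.
Proof.
move=> g0; have C0 : 0 <= C by exact: le_trans (gC point).
have PA0 : P maxsum_unbounded = 0%E.
  have [//|PA1] := ergT measurable_maxsum_unbounded maxsum_unbounded_invariant.
  exfalso; move: g0; apply/negP; rewrite -leNgt.
  pose phi n x := Num.max (g x) (- maxsum n (T x)).
  have phiE n x : phi n x = maxsum n.+1 x - maxsum n (T x).
    rewrite /phi /=; case: (leP (g x)); case: (leP 0); lra.
  have mMT n : measurable_fun [set: X] (fun x => maxsum n (T x)).
    by apply: measurableT_comp => //; exact: measurable_maxsum.
  have mphi n : measurable_fun [set: X] (phi n).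
    by apply: measurable_maxr => //; exact: measurableT_comp.
  (* Since [maxsum] is nonnegative, [phi n] lies between [g] and [max(g, 0)]; this gives the
     dominating constant. *)
  have phiC n x : `|phi n x| <= C.
    have := gC x; have := maxsum_ge0 n (T x).
    by rewrite /phi; case: (leP (g x)) => ?; rewrite !ler_norml => ? /andP[? ?]; lra.
  have iM n : P.-integrable [set: X] (EFin \o maxsum n).
    apply: (@bounded_integrable _ (n%:R * C)); first exact: measurable_maxsum.
    by move=> x; rewrite ger0_norm ?maxsum_ge0// maxsum_le.
  have iMT n : P.-integrable [set: X] (EFin \o (fun x => maxsum n (T x))).
    apply: (@bounded_integrable _ (n%:R * C)) => //.
    by move=> x; rewrite ger0_norm ?maxsum_ge0// maxsum_le.
  have phi0 n : 0 <= \int[P]_x phi n x.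
    under eq_Rintegral do rewrite phiE.
    rewrite RintegralB// Rintegral_invariant; last 2 first.
    - exact: measurable_maxsum.
    - exact: maxsum_ge0.
    by rewrite subr_ge0 le_Rintegral// => x _; exact: maxsum_leS.
  have aeA : {ae P, forall x, maxsum_unbounded x}.
    exists (~` maxsum_unbounded); split => //.
      exact/measurableC/measurable_maxsum_unbounded.
    by rewrite probability_setC ?PA1 ?subee//; exact: measurable_maxsum_unbounded.
  have mEg : measurable_fun [set: X] (EFin \o g) by exact/measurable_EFinP.
  have cvphi : {ae P, forall x, [set: X] x ->
      (EFin \o phi n) x @[n --> \oo] --> (EFin \o g) x}.
    (* By invariance the running maxima are unbounded at [T x] too. Once they exceed [C], the
       maximum defining [phi n x] is attained by [g x], so the sequence is eventually constant. *)
    apply: filterS aeA => x; rewrite -{1}maxsum_unbounded_invariant.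
    move=> /(_ (Num.truncn C).+1 I)[n0 _ /= Cn0] _.
    apply: cvg_near_cst; near=> n; congr EFin; apply: max_idPl.
    have n0n : (n0 <= n)%N by near: n; exact: nbhs_infty_ge.
    have := maxsum_homo (T x) n0n; have := truncnS_gt C.
    by have := gC x; rewrite ler_norml => /andP[? ?]; lra.
  have iC : P.-integrable [set: X] (cst C%:E).
    by apply: finite_measure_integrable_cst.
  have [|_ _ cvI] := dominated_convergence measurableT
    (fun n => (measurable_EFinP _ _).2 (mphi n)) mEg cvphi iC.
    by apply: nearW => x n _; rewrite /= lee_fin.
  apply: fine_ge0; rewrite -(cvg_lim _ cvI)//.
  apply: lime_ge; first by apply/cvg_ex; eexists; exact: cvI.
  apply: nearW => n /=.
  have := phi0 n; rewrite /Rintegral -lee_fin fineK //.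
  by apply: integrable_fin_num => //; exact: bounded_integrable (mphi n) (phiC n).
(* Off this null set some [K] bounds all running maxima, hence all Birkhoff sums. *)
exists maxsum_unbounded; split => //; first exact: measurable_maxsum_unbounded.
move=> x /= Kx K _; apply: contrapT => nK; apply: Kx.
exists K%:R => n; apply: le_trans (sum_le_maxsum _ _) _.
by rewrite leNgt; apply/negP => Kn; apply: nK; exists n.
Unshelve. all: by end_near. Qed.

End maximal_sums.

Lemma ae_average_le (g : X -> R) (C : R) (e : R) :
  measurable_fun [set: X] g -> (forall x, `|g x| <= C) -> 0 < e ->
  {ae P, forall x, exists K : R, forall n,
    \sum_(k < n) g (iter k T x) <= n%:R * (\int[P]_y g y + e) + K}.
Proof.
move=> mg gC e0; set I := Rintegral _ _ _.
have mg' : measurable_fun [set: X] (fun x => g x - (I + e)).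
  by apply: measurable_funB => //; exact: measurable_cst.
have gC' x : `|g x - (I + e)| <= C + `|I + e|.
  by apply: le_trans (ler_normB _ _) _; rewrite lerD2r.
have I' : \int[P]_x (g x - (I + e)) < 0.
  rewrite RintegralB//; last 2 first.
  - exact: bounded_integrable gC.
  - exact: finite_measure_integrable_cst.
  rewrite Rintegral_cst// [X in fine X]probability_setT mulr1 -/I; lra.
apply: filterS (ae_sum_bounded_above mg' gC' I') => x [K HK]; exists K => n.
have := HK n; rewrite sumrB sumr_const card_ord -[_ *+ n]mulr_natl; lra.
Qed.

Theorem ergodic_birkhoff (g : X -> R) (C : R) :
  measurable_fun [set: X] g -> (forall x, `|g x| <= C) ->
  {ae P, forall x,
    n%:R^-1 * (\sum_(k < n) g (iter k T x)) @[n --> \oo] --> \int[P]_y g y}.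
Proof.
move=> mg gC.
have mNg : measurable_fun [set: X] (fun x => - g x) by exact: measurableT_comp.
have NgC x : `|- g x| <= C by rewrite normrN.
(* Restricting the tolerance to the values [1 / (m + 1)] leaves countably many null sets to
   discard. *)
have e0 (m : nat) : 0 < m.+1%:R^-1 :> R by rewrite invr_gt0.
have := ae_foralln (fun m => ae_average_le mNg NgC (e0 m)).
have := ae_foralln (fun m => ae_average_le mg gC (e0 m)).
apply: filterS2 => x U L; apply/cvgrPdist_le => /= e egt0.
(* Half of [e] covers the tolerance [1 / (m + 1)]; the other half absorbs the constants [K] and [K']
   after division by a large [n]. *)
pose m := Num.truncn (2 / e).
have me : m.+1%:R^-1 <= e / 2.
  by rewrite -(invf_div 2 e) lef_pV2 ?posrE ?divr_gt0// ltW// truncnS_gt.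
have [K HK] := U m; have [K' HK'] := L m.
have NI : \int[P]_y - g y = - \int[P]_y g y.
  under eq_Rintegral do rewrite -mulN1r.
  by rewrite RintegralZl ?mulN1r//; exact: bounded_integrable gC.
rewrite NI in HK'.
near=> n.
have n0 : 0 < n%:R :> R by rewrite ltr0n; near: n; exact: nbhs_infty_gt.
have Kn : `|K| + `|K'| <= n%:R * (e / 2).
  rewrite -ler_pdivrMr ?divr_gt0//; near: n.
  exact: nbhs_infty_ger.
have := HK n; have {HK'} := HK' n; rewrite sumrN => HL HU.
have := ler_norm K; have := ler_norm K'; have := normr_ge0 K.
have := normr_ge0 K' => ? ? ? ?.
rewrite distrC -(ler_pM2l n0) -{1}(gtr0_norm n0) -normrM mulrBr mulVKf ?gt_eqF//.
have mn : n%:R * m.+1%:R^-1 <= n%:R * (e / 2) by rewrite ler_pM2l.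
rewrite ler_norml.
move: (\sum_(k < n) _) (Rintegral _ _ _) (m.+1%:R^-1) (n%:R) HL HU mn Kn.
move=> S I q N HL HU mn Kn.
by apply/andP; split; lra.
Unshelve. all: by end_near. Qed.
End Birkhoff.

(** * Cesaro averages and reduction of the autocorrelation to one-sided averages *)

Section Averages.
Context {R : realType}.

Lemma cvg0_mul_bounded (c u : nat -> R) (C : R) :
  c n @[n --> \oo] --> 0 -> (forall n, `|u n| <= C) ->
  c n * u n @[n --> \oo] --> 0.
Proof.
move=> c0 uC; apply/norm_cvg0P.
apply: (@squeeze_cvgr _ _ _ _ (fun=> 0) (fun n => `|c n| * C)).
- by apply: nearW => n; rewrite normr_ge0 normrM ler_wpM2l.
- exact: cvg_cst.
- rewrite -[X in _ --> X](mul0r C); apply: cvgMr_tmp.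
  by rewrite -(normr0 R); exact: cvg_norm.
Qed.

Lemma cvg_inv_natr : (n%:R^-1 : R) @[n --> \oo] --> 0.
Proof. by rewrite -cvg_shiftS; exact: cvg_harmonic. Qed.

Lemma cvg_inv_oddr : ((2 * n).+1%:R^-1 : R) @[n --> \oo] --> 0.
Proof.
apply: (@squeeze_cvgr _ _ _ _ (fun=> 0) harmonic).
- apply: nearW => n; rewrite invr_ge0 ler0n/= lef_pV2 ?posrE// ler_nat; lia.
- exact: cvg_cst.
- exact: cvg_harmonic.
Qed.

(** Each extra unit of shift changes the sum by [a (n + p) - a p], which is bounded and so
    disappears after division by [n]. *)
Lemma average_shift (a : nat -> R) (C : R) (p : nat) (l : R) :
  (forall k, `|a k| <= C) ->
  (n%:R^-1 * (\sum_(k < n) a (k + p)%N) @[n --> \oo] --> l) <->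
  (n%:R^-1 * (\sum_(k < n) a k) @[n --> \oo] --> l).
Proof.
elim: p a => [|p IH] a aC; first by under eq_fun do under eq_bigr do rewrite addn0.
rewrite -(IH a aC).
have d0 : n%:R^-1 * (a (n + p)%N - a p) @[n --> \oo] --> 0.
  apply: (cvg0_mul_bounded (C := C + C)) => [|n]; first exact: cvg_inv_natr.
  by apply: le_trans (ler_normB _ _) _; exact: lerD.
have E n : n%:R^-1 * (\sum_(k < n) a (k + p.+1)%N) =
    n%:R^-1 * (\sum_(k < n) a (k + p)%N) + n%:R^-1 * (a (n + p)%N - a p).
  rewrite -mulrDr; congr (_ * _).
  have : \sum_(k < n.+1) a (k + p)%N = \sum_(k < n) a (k + p)%N + a (n + p)%N.
    exact: big_ord_recr.
  have -> : \sum_(k < n.+1) a (k + p)%N = a p + \sum_(k < n) a (k + p.+1)%N.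
    by rewrite big_ord_recl; congr (_ + _); apply: eq_bigr => i _; rewrite lift0 addSnnS.
  lra.
split => [H|H].
- have -> : (fun n => n%:R^-1 * (\sum_(k < n) a (k + p)%N)) =
     (fun n => n%:R^-1 * (\sum_(k < n) a (k + p.+1)%N) - n%:R^-1 * (a (n + p)%N - a p)).
    by apply/funext => n; rewrite E addrK.
  by rewrite -[l]subr0; exact: cvgB.
- by under eq_fun do rewrite E; rewrite -[l]addr0; exact: cvgD.
Qed.

Lemma symmetric_sum (F : int -> R) (n : nat) :
  \sum_(0 <= i < (2 * n).+1) F (i%:Z - n%:Z) =
  \sum_(k < n) F (- k.+1%:Z) + \sum_(k < n.+1) F k%:Z.
Proof.
rewrite (@big_cat_nat _ _ _ n) /=; [|lia|lia]; congr (_ + _).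
  rewrite big_nat_rev /= -[RHS](big_mkord xpredT (fun k => F (- k.+1%:Z))).
  by rewrite big_nat [RHS]big_nat; apply: eq_bigr => i /andP[_ i_n]; congr F; lia.
rewrite -{1}[n]add0n big_addn.
rewrite -[RHS](big_mkord xpredT (fun k => F k%:Z)).
have -> : ((2 * n).+1 - n = n.+1)%N by lia.
by apply: eq_bigr => i _; congr F; lia.
Qed.

Lemma sum_ltn (N p : nat) : (\sum_(0 <= i < N) (i < p)%N <= p)%N.
Proof.
suff -> : (\sum_(0 <= i < N) (i < p) = minn N p)%N by lia.
by elim: N => [|N IH]; [rewrite big_geq//; lia|rewrite big_nat_recr//= IH; lia].
Qed.

(** Translation by [z] can leave the window only from an index within [|z|] of one of its two ends;
    each end contributes at most [|z|] indices. *)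
Lemma count_shift_out (n : nat) (z : int) :
  (\sum_(0 <= i < (2 * n).+1)
    nat_of_bool (~~ (`|i%:Z - n%:Z - z| <= n%:Z)%R) <= 2 * `|z|)%N.
Proof.
apply: (@leq_trans (\sum_(0 <= i < (2 * n).+1)
    (nat_of_bool (i < `|z|)%N + nat_of_bool (0 + (2 * n).+1 - i.+1 < `|z|)%N))%N).
  by rewrite big_nat [leqRHS]big_nat; apply: leq_sum => i /andP[_ iN]; lia.
rewrite big_split [leqRHS]mul2n -addnn; apply: leq_add; first exact: sum_ltn.
by rewrite -(big_nat_rev _ _ _ _ xpredT (fun i => nat_of_bool (i < `|z|)%N)) sum_ltn.
Qed.

Lemma autocorr_seq_cvg (m : int -> R) (C : R) (z : int) (a b : R) :
  (forall x, `|m x| <= C) ->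
  n%:R^-1 * (\sum_(k < n) m k%:Z * m (k%:Z - z)) @[n --> \oo] --> a ->
  n%:R^-1 * (\sum_(k < n) m (- k.+1%:Z) * m (- k.+1%:Z - z)) @[n --> \oo] --> b ->
  autocorr_seq m n z @[n --> \oo] --> 2^-1 * (a + b).
Proof.
move=> mC cva cvb.
(* [E n] collects the products lost by truncation: [x] lies in the window but [x - z] does not. *)
pose E n := \sum_(0 <= i < (2 * n).+1)
  m (i%:Z - n%:Z) * (if `|i%:Z - n%:Z - z| <= n%:Z then 0 else m (i%:Z - n%:Z - z)).
have EC n : `|E n| <= C * C * (2 * `|z|)%N%:R.
  apply: le_trans (ler_norm_sum _ _ _) _.
  apply: (@le_trans _ _ (\sum_(0 <= i < (2 * n).+1)
      C * C * (~~ (`|i%:Z - n%:Z - z| <= n%:Z))%:R)).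
    apply: ler_sum => i _; rewrite normrM; case: ifP => _ /=.
      by rewrite normr0 !mulr0.
    by rewrite mulr1 ler_pM.
  rewrite -mulr_sumr -natr_sum ler_wpM2l ?ler_nat ?count_shift_out//.
  by rewrite mulr_ge0// (le_trans _ (mC 0)).
(* The weights are [n / (2n + 1)] for the negative half and [(n + 1) / (2n + 1)] for the half
   containing 0, written as 1/2 plus a vanishing correction. *)
have autoE n : autocorr_seq m n z =
    (2^-1 - 2^-1 * (2 * n).+1%:R^-1) *
      (n%:R^-1 * (\sum_(k < n) m (- k.+1%:Z) * m (- k.+1%:Z - z))) +
    (2^-1 + 2^-1 * (2 * n).+1%:R^-1) *
      (n.+1%:R^-1 * (\sum_(k < n.+1) m k%:Z * m (k%:Z - z))) -
    (2 * n).+1%:R^-1 * E n.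
  have -> : autocorr_seq m n z = (2 * n).+1%:R^-1 *
      (\sum_(0 <= i < (2 * n).+1) m (i%:Z - n%:Z) * m (i%:Z - n%:Z - z) - E n).
    congr (_ * _); rewrite /conv_n -sumrB big_nat [RHS]big_nat.
    apply: eq_bigr => i /andP[_ iN]; rewrite /tilde {1}/restr ifT; last by lia.
    rewrite -mulrBr opprB /restr; case: ifP => _; first by rewrite subr0.
    by rewrite subrr.
  rewrite mulrBr (symmetric_sum (fun x => m x * m (x - z))) mulrDr.
  congr (_ + _ - _); rewrite mulrA; last first.
    congr (_ * _); rewrite -[n.+1%:R]natr1 -natr1 natrM.
    by field; rewrite -natrM !natr1 !pnatr_eq0.
  (* At [n = 0] the factor [n] does not cancel its inverse, but the negative half is empty. *)
  have [->|n0] := eqVneq n 0; first by rewrite !big_ord0 !mulr0.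
  congr (_ * _); rewrite -natr1 natrM.
  by field; rewrite -natrM natr1 !pnatr_eq0 n0.
under eq_fun do rewrite autoE.
have -> : 2^-1 * (a + b) = (2^-1 - 2^-1 * 0) * b + (2^-1 + 2^-1 * 0) * a - 0 by ring.
have cvh : (2^-1 * (2 * n).+1%:R^-1 : R) @[n --> \oo] --> (2^-1 * 0 : R).
  by apply: cvgMl_tmp; exact: cvg_inv_oddr.
apply: cvgB; last exact: cvg0_mul_bounded cvg_inv_oddr EC.
apply: cvgD; apply: cvgM => //.
- by apply: cvgB => //; exact: cvg_cst.
- by apply: cvgD => //; exact: cvg_cst.
- by rewrite (cvg_shiftS (fun n => n%:R^-1 * (\sum_(k < n) m k%:Z * m (k%:Z - z)))).
Qed.

End Averages.

(** * Transfer of the ergodic theorem to the unit interval *)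

Section UnitInterval.
Context {R : realType}.

Lemma measurable_I01 : measurable (@I01 R).
Proof. exact: measurable_itv. Qed.

Lemma iter_I01 (T : R -> R) (hTmap : forall x, I01 x -> I01 (T x)) k x :
  I01 x -> I01 (iter k T x).
Proof. by move=> Ix; elim: k => //= k IH; exact: hTmap. Qed.

Lemma measurable_iter_I01 (T : R -> R) (hTmap : forall x, I01 x -> I01 (T x)) k :
  measurable_fun I01 T -> measurable_fun I01 (iter k T).
Proof.
move=> mT; elim: k => [|k IH]; first exact: measurable_id.
apply: (@measurable_comp _ _ _ _ _ _ I01 T) => //; first exact: measurable_I01.
by move=> _ [x Ix <-]; exact: iter_I01.
Qed.

(** Extending [T] and [g] by zero off [I01] gives measurable functions on the whole line. Because
    [eta] is carried by [I01], invariance and ergodicity pass to the extension, and orbits starting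
    in [I01] are unchanged. *)
Lemma ergodic_birkhoff_I01 (eta : probability R R) (T g : R -> R) (C : R) :
  (forall x, I01 x -> I01 (T x)) -> measurable_fun I01 T ->
  eta I01 = 1%E ->
  (forall A : set R, measurable A -> A `<=` I01 ->
    eta (I01 `&` T @^-1` A) = eta A) ->
  (forall A : set R, measurable A -> A `<=` I01 ->
    I01 `&` T @^-1` A = A -> eta A = 0%E \/ eta A = 1%E) ->
  measurable_fun I01 g -> (forall x, I01 x -> `|g x| <= C) ->
  {ae eta, forall y, I01 y ->
    n%:R^-1 * (\sum_(k < n) g (iter k T y)) @[n --> \oo]
      --> \int[eta]_(x in I01) g x}.
Proof.
move=> TI mT eta1 invT ergT mg gC.
have mI := measurable_I01.
have mT' : measurable_fun [set: R] (T \_ I01) by apply/(measurable_restrictT _ mI).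
have mg' : measurable_fun [set: R] (g \_ I01) by apply/(measurable_restrictT _ mI).
have etaI A : measurable A -> eta (I01 `&` A) = eta A.
  move=> mA; rewrite [RHS](measureDI eta mA mI) [X in (X + _)%E]( _ : _ = 0%E).
    by rewrite add0e setIC.
  apply: (@subset_measure0 _ _ _ eta _ (~` I01)).
  - exact: measurableD.
  - exact: measurableC.
  - by move=> x [].
  - have etaC : eta (~` I01) = 0%E by rewrite probability_setC// eta1 subee.
    exact: etaC.
have TE x : I01 x -> (T \_ I01) x = T x by move=> Ix; rewrite patchE mem_set.
have mpre A : measurable A -> measurable ((T \_ I01) @^-1` A).
  by move=> mA; rewrite -[X in measurable X]setTI; exact: mT'.
have preE A : I01 `&` (T \_ I01) @^-1` A = I01 `&` T @^-1` (I01 `&` A).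
  apply/seteqP; split => x [Ix] /=; rewrite TE// => Ax; split => //.
    by split => //; exact: TI.
  by case: Ax.
have inv' A : measurable A -> eta ((T \_ I01) @^-1` A) = eta A.
  move=> mA; rewrite -(etaI _ (mpre _ mA)) preE invT ?etaI//.
  exact: measurableI.
have erg' A : measurable A -> (T \_ I01) @^-1` A = A -> eta A = 0%E \/ eta A = 1%E.
  move=> mA TA; rewrite -(etaI _ mA); apply: ergT; first exact: measurableI.
    by move=> x [].
  by rewrite -preE TA.
have g'C x : `|(g \_ I01) x| <= C.
  rewrite patchE; case: ifPn => [/set_mem/gC//|_].
  by rewrite normr0 (le_trans _ (gC 0 _))// /I01/= in_itv/= lexx ler01.
rewrite Rintegral_mkcond.
have iterE k y : I01 y -> (g \_ I01) (iter k (T \_ I01) y) = g (iter k T y).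
  move=> Iy; have -> : iter k (T \_ I01) y = iter k T y.
    by elim: k => //= k ->; rewrite TE//; exact: iter_I01.
  by rewrite patchE mem_set//; exact: iter_I01.
apply: filterS (ergodic_birkhoff mT' inv' erg' mg' g'C) => y + Iy.
by under eq_fun do under eq_bigr do rewrite iterE//.
Qed.

Lemma Tpow_inverse (T : R -> R) : invertible T ->
  [/\ (forall x, I01 x -> I01 (Tinv T x)),
      (forall x, I01 x -> Tinv T (T x) = x),
      (forall x, I01 x -> T (Tinv T x) = x) &
      measurable_fun I01 (Tinv T)].
Proof. by move=> Ti; rewrite /Tinv; case: pselect => // Ti'; case: cid. Qed.

(** * Integer powers of an invertible map *)

Section Tpow.
Variable T : R -> R.
Hypotheses (TI : forall x, I01 x -> I01 (T x)) (Ti : invertible T).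

Lemma Tpow_I01 z x : I01 x -> I01 (Tpow T z x).
Proof.
have [SI _ _ _] := Tpow_inverse Ti.
by case: z => n; exact: iter_I01.
Qed.

Lemma TpowS z x : I01 x -> Tpow T (z + 1) x = T (Tpow T z x).
Proof.
have [SI _ TS _] := Tpow_inverse Ti.
case: z => [n|[|n]] Ix; first by rewrite -PoszD addn1.
  by rewrite /= TS.
have -> : Negz n.+1 + 1 = Negz n by rewrite !NegzE; lia.
by rewrite /= TS//; exact/SI/(iter_I01 SI).
Qed.

Lemma TpowP z x : I01 x -> Tpow T (z - 1) x = Tinv T (Tpow T z x).
Proof.
have [SI ST _ _] := Tpow_inverse Ti.
by move=> Ix; rewrite -{2}(subrK 1 z) TpowS// ST//; exact: Tpow_I01.
Qed.

(** This turns the factor at [x - z] into [T] to the power [-z] applied to the orbit point at time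
    [x]. Points stay in [I01], where the inverse laws hold. *)
Lemma TpowD z w x : I01 x -> Tpow T (z + w) x = Tpow T z (Tpow T w x).
Proof.
move=> Ix; have Iw := Tpow_I01 w Ix.
elim/int_rect: z => [|n IH|n IH]; first by rewrite add0r.
- by rewrite -addn1 PoszD addrAC !TpowS// IH.
- by rewrite -addn1 PoszD opprD addrAC !TpowP// IH.
Qed.

End Tpow.
End UnitInterval.

(** * Autocorrelation of the return time measures *)

Theorem theorem3p1 (R : realType) (T : R -> R) (eta : probability R R)
  (f : R -> R)
  (* T : [0,1] -> [0,1] Borel measurable *)
  (hTmap : forall x, @I01 R x -> I01 (T x))
  (hTmeas : measurable_fun I01 T)
  (* eta is a Borel probability measure on [0,1] *)
  (heta01 : eta I01 = 1%E)
  (* eta is T-invariant *)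
  (hinv : forall A : set R, measurable A -> A `<=` I01 ->
            eta (I01 `&` T @^-1` A) = eta A)
  (* eta is ergodic *)
  (herg : forall A : set R, measurable A -> A `<=` I01 ->
            I01 `&` T @^-1` A = A -> eta A = 0%E \/ eta A = 1%E)
  (* f in L^1(eta), real-valued, non-negative, bounded *)
  (hfmeas : measurable_fun I01 f)
  (hfint : eta.-integrable I01 (EFin \o f))
  (hfnn : forall x, I01 x -> 0 <= f x)
  (hfbd : exists M : R, forall x, I01 x -> f x <= M) :
  {ae eta, forall y : R,
     forall z : int,
       (fun n : nat => autocorr_seq (return_measure T f y) n z) @ \oo
         --> Xi T eta f z}.

Proof.
have mI := @measurable_I01 R.
have [M fM] := hfbd.
have fn x : I01 x -> `|f x| <= M by move=> Ix; rewrite ger0_norm ?fM ?hfnn.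
have mfT (S : R -> R) : (forall x, I01 x -> I01 (S x)) -> measurable_fun I01 S ->
    measurable_fun I01 (fun x => f (S x) * f x).
  move=> SI mS; apply: measurable_funM => //.
  by apply: (@measurable_comp _ _ _ _ _ _ I01 f) => // _ [x Ix <-]; exact: SI.
have fTC (S : R -> R) x : (forall x, I01 x -> I01 (S x)) -> I01 x ->
    `|f (S x) * f x| <= M * M.
  by move=> SI Ix; rewrite normrM ler_pM ?fn//; exact: SI.
have mC y : I01 y -> forall x, `|return_measure T f y x| <= M.
  move=> Iy x; rewrite /return_measure; case: asboolP => [Ti|_].
    by apply: fn; exact: Tpow_I01.
  case: ifP; last by rewrite normr0 (le_trans _ (fn _ Iy)).
  by case: x => // k _; apply: fn; exact: iter_I01.
have mmC y : I01 y -> forall x x',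
    `|return_measure T f y x * return_measure T f y x'| <= M * M.
  by move=> Iy x x'; rewrite normrM ler_pM ?mC.
have aeI : {ae eta, forall y, I01 y}.
  exists (~` I01); split => //; first exact: measurableC.
  by rewrite probability_setC// heta01 subee.
have [Ti|nTi] := pselect (invertible T).
- have [SI ST TS mS] := Tpow_inverse Ti.
  set S := Tinv T in SI ST TS mS.
  have mTp z : measurable_fun I01 (Tpow T z).
    by case: z => n; exact: measurable_iter_I01.
  pose g (z : int) (x : R) := f (Tpow T (- z) x) * f x.
  have mg z : measurable_fun I01 (g z) by apply: mfT => // x; exact: Tpow_I01.
  have gC z x : I01 x -> `|g z x| <= M * M.
    by move=> Ix; apply: fTC => // y; exact: Tpow_I01.
  (* Apply the invariance of [T] to the preimage of [A] under [S]: pulling it back along [T] returns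
     [A]. *)
  have invS A : measurable A -> A `<=` I01 -> eta (I01 `&` S @^-1` A) = eta A.
    move=> mA AI; rewrite -hinv; last 2 first.
    - exact: mS.
    - by move=> x [].
    congr (eta _); apply/seteqP; split => x /=.
      by move=> [Ix [_]]; rewrite ST.
    by move=> Ax; have Ix := AI _ Ax; rewrite ST//; do 2?split => //; exact: hTmap.
  (* A set invariant under [S] is invariant under [T], so ergodicity carries over. *)
  have ergS A : measurable A -> A `<=` I01 -> I01 `&` S @^-1` A = A ->
      eta A = 0%E \/ eta A = 1%E.
    move=> mA AI SA; apply: herg => //; apply/seteqP; split => x /=.
      by move=> [Ix]; rewrite -{1}SA /= ST// => -[].
    move=> Ax; have Ix := AI _ Ax; split => //; rewrite -SA /= ST//.
    by split => //; exact: hTmap.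
  have aeT z := ergodic_birkhoff_I01 hTmap hTmeas heta01 hinv herg (mg z) (@gC z).
  have aeS z := ergodic_birkhoff_I01 SI mS heta01 invS ergS (mg z) (@gC z).
  have aeTS z : {ae eta, forall y, I01 y ->
      (n%:R^-1 * (\sum_(k < n) g z (iter k T y)) @[n --> \oo]
        --> \int[eta]_(x in I01) g z x) /\
      (n%:R^-1 * (\sum_(k < n) g z (iter k S y)) @[n --> \oo]
        --> \int[eta]_(x in I01) g z x)}.
    by apply: filterS2 (aeT z) (aeS z) => y a b Iy; split; [exact: a|exact: b].
  (* A null set common to all integers [z] is assembled from the two families indexed by
     naturals. *)
  have aeP := ae_foralln (fun n => aeTS (Posz n)).
  have aeN := ae_foralln (fun n => aeTS (Negz n)).
  apply: filterS3 aeI aeP aeN => y Iy bP bN z.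
  have [bT bS] : _ /\ _ := match z with Posz n => bP n Iy | Negz n => bN n Iy end.
  have mE x : return_measure T f y x = f (Tpow T x y).
    by rewrite /return_measure asboolT.
  have mg_ x : return_measure T f y x * return_measure T f y (x - z) = g z (Tpow T x y).
    by rewrite !mE addrC TpowD// mulrC.
  have -> : Xi T eta f z =
      2^-1 * (\int[eta]_(x in I01) g z x + \int[eta]_(x in I01) g z x).
    by rewrite /Xi asboolT//; lra.
  apply: (autocorr_seq_cvg (mC _ Iy)).
    by under eq_fun do under eq_bigr do rewrite mg_.
  (* The negative half starts at time -1, so it is the orbit of [y] under [S] shifted by one. *)
  have mgN k : return_measure T f y (- k.+1%:Z) *
      return_measure T f y (- k.+1%:Z - z) = g z (iter (k + 1) S y).
    by rewrite mg_ -NegzE addn1.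
  under eq_fun do under eq_bigr do rewrite mgN.
  apply/(average_shift (a := fun k => g z (iter k S y)) 1 (C := M * M)) => // k.
  by apply: gC; exact: iter_I01.
- pose g p x := f (iter p T x) * f x.
  have mg p : measurable_fun I01 (g p).
    by apply: mfT => [x|]; [exact: iter_I01|exact: measurable_iter_I01].
  have gC p x : I01 x -> `|g p x| <= M * M.
    by move=> Ix; apply: fTC => // y; exact: iter_I01.
  have aeT p := ergodic_birkhoff_I01 hTmap hTmeas heta01 hinv herg (mg p) (@gC p).
  apply: filterS2 aeI (ae_foralln aeT) => y Iy bT z.
  have mP k : return_measure T f y (Posz k) = f (iter k T y).
    by rewrite /return_measure asboolF.
  have mN k : return_measure T f y (Negz k) = 0.
    by rewrite /return_measure asboolF.
  have -> : Xi T eta f z = 2^-1 * (\int[eta]_(x in I01) g `|z|%N x + 0).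
    by rewrite /Xi asboolF// addr0; case: z.
  (* The return measure has no mass at negative times, so the second average is zero and the factor
     1/2 survives. *)
  apply: (autocorr_seq_cvg (mC _ Iy)); last first.
    under eq_fun do under eq_bigr do rewrite -NegzE mN mul0r.
    under eq_fun do rewrite big1// mulr0.
    exact: cvg_cst.
  case: z => p /=.
    apply/(average_shift (a := fun k => return_measure T f y (Posz k) *
      return_measure T f y (k%:Z - p%:Z)) p _
      (fun k => mmC _ Iy k%:Z (k%:Z - p%:Z))).
    under eq_fun do under eq_bigr do
      rewrite PoszD addrK -PoszD !mP addnC iterD.
    exact: bT.
  under eq_fun do under eq_bigr do
    rewrite NegzE opprK -PoszD !mP mulrC addnC iterD.
  exact: bT.
Qed.
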